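(* Let $p\in(0,1)$ and let $\varepsilon_p$ be a random variable taking the value $1$ with probability $p$ and the value $0$ with probability $1-p$. Let $X,Y$ be independent identically distributed random variables that are positive almost surely, and suppose that $\varepsilon_p$ is independent of $(X,Y)$. Let $a,b$ be positive constants and consider the linear forms $$L_1=(1-p)\,a\,X+\varepsilon_p\, a\, Y,\qquad L_2=p\,b\,X+(1-\varepsilon_p)\,b\,Y.$$ Then $L_1$ and $L_2$ are independent if and only if $X$ and $Y$ have an exponential distribution.
   Context: ''Exponential distribution'' means an exponential distribution on $(0,\infty)$ with an arbitrary scale parameter $\lambda>0$, i.e. the distribution with Laplace transform $\mathbb{E}e^{-sX}=1/(1+\lambda s)$, $s\ge 0$, for some $\lambda>0$. *)

(* Defs.v *)
From HB Require Import structures.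
From mathcomp Require Import all_boot all_order all_algebra.
From mathcomp Require Import all_classical all_reals all_analysis.

Set Implicit Arguments.
Unset Strict Implicit.
Unset Printing Implicit Defensive.

Import Order.TTheory GRing.Theory Num.Theory.

Local Open Scope classical_set_scope.
Local Open Scope ring_scope.

(* Product rule on all pairs of measurable sets.  [U] and [V] are plain functions
   so that pairs and linear forms of random variables need no bundling; the
   notion is meant for measurable [U] and [V]. *)
Definition independent_RV {d d1 d2 : measure_display} {T : measurableType d}
    {T1 : measurableType d1} {T2 : measurableType d2} {R : realType}
    (P : probability T R) (U : T -> T1) (V : T -> T2) : Prop :=
  forall (A : set T1) (B : set T2), measurable A -> measurable B ->
    P (U @^-1` A `&` V @^-1` B) = (P (U @^-1` A) * P (V @^-1` B))%E.

(* Laws are compared on measurable sets only: the value of a measure outside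
   the sigma-algebra carries no meaning. *)
Definition identically_distributed {d d' : measure_display}
    {T : measurableType d} {T' : measurableType d'} {R : realType}
    (P : probability T R) (U V : {RV P >-> T'}) : Prop :=
  forall A : set T', measurable A -> distribution P U A = distribution P V A.

(* [lambda] is the scale (Laplace transform [s |-> 1 / (1 + lambda s)]), whereas
   [exponential_prob] is parameterised by the rate. *)
Definition exponentially_distributed {d : measure_display}
    {T : measurableType d} {R : realType}
    (P : probability T R) (X : {RV P >-> R}) : Prop :=
  exists2 lambda : R, 0 < lambda &
    forall A : set R, measurable A ->
      distribution P X A = exponential_prob lambda^-1 A.

(* Main.v *)
(** Let [phi] be the Laplace transform of [X] and [q = 1 - p]. Conditioning on
    [eps], the joint transform of [L1] and [L2] at [(s/a, t/b)] is
    [phi (q s + p t) (p phi s + q phi t)].  When [phi s = 1 / (1 + lambda s)]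
    this factors.  Conversely, if it factors, i.e. equals
    [phi (q s) (p phi s + q) * phi (p t) (p + q phi t)], then letting one
    argument tend to infinity shows [1 / phi] to be affine.  In both directions
    transforms are inverted by approximating the indicator of [c < x] with
    polynomials in [exp (- s x)], namely [(1 - v ^ n) ^ (n 2^n)] for
    [v = exp (- s x)], which tends to the indicator of [v < 1/2]. *)
Require Import Defs.
From HB Require Import structures.
From mathcomp Require Import all_boot all_order all_algebra.
From mathcomp Require Import all_classical all_reals all_analysis.
From mathcomp Require Import measurable_realfun ring lra.

Set Implicit Arguments.
Unset Strict Implicit.
Unset Printing Implicit Defensive.

Import Order.TTheory GRing.Theory Num.Theory.
Import numFieldNormedType.Exports.

Local Open Scope classical_set_scope.
Local Open Scope ring_scope.

(** * Polynomials approximating a step function *)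

(** For [u = sqrt r], the bound [n u^n <= 1 / (1 - u)] gives [n r^n <= u^n / (1 - u)], whose right
    side tends to 0. *)
Lemma mul_exprn_cvg0 (R : realType) (r : R) : 0 <= r < 1 ->
  (fun n => n%:R * r ^+ n) @ \oo --> 0.
Proof.
move=> /andP[r0 r1]; set u := Num.sqrt r.
have u0 : 0 <= u by exact: sqrtr_ge0.
have u1 : u < 1 by rewrite -sqrtr1 ltr_sqrt.
have uu : u ^+ 2 = r by rewrite sqr_sqrtr.
have bnd n : n%:R * u ^+ n <= (1 - u)^-1.
  rewrite -[leRHS]mul1r ler_pdivlMr ?subr_gt0//.
  have un k : 0 <= u ^+ k <= 1 by rewrite exprn_ge0// exprn_ile1// ltW.
  suff h : n%:R * (1 - u) * u ^+ n <= 1 - u ^+ n.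
    by rewrite mulrAC (le_trans h)// gerBl; case/andP: (un n).
  elim: n => [|n IH]; first by rewrite expr0 !mul0r subrr.
  move: IH (un n); rewrite exprS -natr1; set w := u ^+ n => IH /andP[w0 w1].
  have h1 : u * (n%:R * (1 - u) * w) <= u * (1 - w) by rewrite ler_wpM2l.
  have h2 : (1 - u) * (u * w) <= (1 - u) * 1.
    by rewrite ler_wpM2l ?subr_ge0 ?mulr_ile1// ltW.
  lra.
apply: (@squeeze_cvgr _ _ _ _ (cst 0) (fun n => (1 - u)^-1 * u ^+ n)).
- apply: nearW => n /=; apply/andP; split; first by rewrite mulr_ge0// exprn_ge0.
  by rewrite -uu -exprM mulnC exprM expr2 mulrA ler_wpM2r ?exprn_ge0.
- exact: cvg_cst.
- rewrite -[X in _ --> X](mulr0 (1 - u)^-1); apply: cvgMr.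
  by apply: cvg_expr; rewrite ger0_norm.
Qed.

Lemma bernoulli_ineq (R : realDomainType) (x : R) n : 0 <= x <= 1 ->
  1 - n%:R * x <= (1 - x) ^+ n.
Proof.
move=> /andP[x0 x1]; elim: n => [|n IH]; first by rewrite mul0r subr0 expr0.
rewrite exprS -natr1; have : (1 - x) * (1 - n%:R * x) <= (1 - x) * (1 - x) ^+ n.
  by rewrite ler_wpM2l// subr_ge0.
by have : 0 <= n%:R * x ^+ 2 by [rewrite mulr_ge0// sqr_ge0]; nra.
Qed.

Definition step_poly (R : realType) (n : nat) : {poly R} :=
  (1 - 'X^n) ^+ (n * 2 ^ n).

Lemma step_polyE (R : realType) n (v : R) :
  (step_poly R n).[v] = (1 - v ^+ n) ^+ (n * 2 ^ n).
Proof. by rewrite horner_exp !hornerE. Qed.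

Lemma step_poly_bound (R : realType) n (v : R) : 0 <= v <= 1 ->
  0 <= (step_poly R n).[v] <= 1.
Proof.
move=> /andP[v0 v1]; rewrite step_polyE.
have ? : 0 <= 1 - v ^+ n by rewrite subr_ge0 exprn_ile1.
by rewrite exprn_ge0// exprn_ile1// gerBl exprn_ge0.
Qed.

(* The extra factor [n] in the exponent [n * 2 ^ n] makes the limit vanish at
   the threshold [v = 1/2] as well. *)
Lemma cvg_step_poly (R : realType) (v : R) : 0 <= v <= 1 ->
  (fun n => (step_poly R n).[v]) @ \oo --> ((v < 2^-1)%R%:R : R).
Proof.
move=> /andP[v0 v1].
have vn n : 0 <= v ^+ n <= 1 by rewrite exprn_ge0// exprn_ile1.
case: ltP => v2 /=.
  (* Below the threshold, Bernoulli's inequality gives the lower bound [1 - n (2v)^n], where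
     [2v < 1]. *)
  apply: (@squeeze_cvgr _ _ _ _ (fun n => 1 - n%:R * (2 * v) ^+ n) (cst 1)).
  - apply: nearW => n /=; rewrite (andP (step_poly_bound _ _)).2 ?v0 ?v1// andbT.
    rewrite step_polyE (le_trans _ (bernoulli_ineq _ _))//.
    by rewrite natrM natrX exprMn mulrA.
  - rewrite -[X in _ --> X]subr0; apply: cvgB; first exact: cvg_cst.
    by apply: mul_exprn_cvg0; lra.
  - exact: cvg_cst.
(* From the threshold on, [1 - x <= exp (- x)] bounds the value by
   [exp (- n (2v)^n) <= 1 / (1 + n)], since [2v >= 1]. *)
apply: (@squeeze_cvgr _ _ _ _ (cst 0) harmonic); last 2 first.
- exact: cvg_cst.
- exact: cvg_harmonic.
apply: nearW => n /=; rewrite (andP (step_poly_bound _ _)).1 ?v0 ?v1//=.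
rewrite step_polyE /harmonic.
apply: (@le_trans _ _ (expR (- v ^+ n) ^+ (n * 2 ^ n))).
  by apply: lerXn2r; rewrite ?nnegrE ?expR_ge0 ?subr_ge0 ?(andP (vn n)).2// expR_ge1Dx.
rewrite -expRM_natl mulrN expRN lef_pV2 ?posrE ?expR_gt0//.
apply: (le_trans _ (expR_ge1Dx _)).
rewrite -natr1 addrC lerD2l natrM natrX -mulrA ler_peMr//.
rewrite -exprMn exprn_ege1//; lra.
Qed.

(** * Solving the functional equation *)

(** Additivity and nonnegativity make [g] monotone. For an integer [m] with [m <= n x < m + 1] this
    squeezes [n g x] between [m g 1] and [(m + 1) g 1], so that [n |g x - g 1 x| <= g 1] for every
    [n], which forces equality. *)
Lemma monotone_additive_linear (R : realType) (g : R -> R) :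
  (forall x y, 0 <= x -> 0 <= y -> g (x + y) = g x + g y) ->
  (forall x, 0 <= x -> 0 <= g x) ->
  forall x, 0 <= x -> g x = g 1 * x.
Proof.
move=> gD g0 x x0.
have gM n y : 0 <= y -> g (n%:R * y) = n%:R * g y.
  move=> y0; elim: n => [|n IH].
    by rewrite !mul0r; have := gD 0 0 (lexx _) (lexx _); rewrite addr0; lra.
  by rewrite -natr1 !mulrDl !mul1r gD ?mulr_ge0// IH.
have g_nd y z : 0 <= y -> y <= z -> g y <= g z.
  by move=> y0 yz; rewrite -(subrK y z) addrC gD ?subr_ge0// lerDl g0// subr_ge0.
have bnd n : n%:R * `|g x - g 1 * x| <= g 1.
  rewrite -[n%:R]ger0_norm// -normrM.
  have nx0 : 0 <= n%:R * x by rewrite mulr_ge0.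
  have /andP[m1 m2] := truncn_itv nx0.
  move: m1 m2; set m := Num.truncn _ => m1 m2.
  have := g_nd _ _ _ m1; have := g_nd _ _ nx0 (ltW m2).
  rewrite -[m.+1%:R]mulr1 -[m%:R]mulr1 !gM// mulr1 => h1 /(_ (ler0n _ _)) h2.
  have g10 := g0 1 ler01.
  rewrite ler_norml -natr1 in h1 m2 *; apply/andP; split; nra.
apply/eqP; rewrite -subr_eq0 -normr_eq0; apply/eqP/le_anti; rewrite normr_ge0 andbT.
rewrite leNgt; apply/negP => D0.
have := bnd (Num.truncn (g 1 / `|g x - g 1 * x|)).+1.
rewrite leNgt => /negP; apply.
by rewrite -ltr_pdivrMr// truncnS_gt.
Qed.

(* Letting [t] tend to infinity in the equation bounds
   [C s := phi (q s) (p phi s + q) / phi s] by 1, and symmetrically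
   [D t := phi (p t) (p + q phi t) / phi t]. At [s = t] the equation reads
   [C s * D s = 1], so that [C = D = 1], and [1 / phi] is affine. *)
Lemma linear_forms_functional_equation (R : realType) (p : R) (phi : R -> R) :
  0 < p < 1 ->
  (forall s, 0 <= s -> 0 < phi s) ->
  (forall s t, 0 <= s -> s <= t -> phi t <= phi s) ->
  phi 0 = 1 ->
  (forall e, 0 < e -> exists2 t, 0 <= t & phi t < e) ->
  (forall s t, 0 <= s -> 0 <= t ->
    phi ((1 - p) * s + p * t) * (p * phi s + (1 - p) * phi t) =
    (phi ((1 - p) * s) * (p * phi s + (1 - p))) *
    (phi (p * t) * (p + (1 - p) * phi t))) ->
  exists2 lambda, 0 < lambda & forall s, 0 <= s -> phi s = (1 + lambda * s)^-1.
Proof.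
move=> /andP[p0 p1] phi_gt0 phi_ni phi0 phi_inf eq.
set q := 1 - p in eq *; have q0 : 0 < q by rewrite subr_gt0.
have pq : p = 1 - q by rewrite /q; lra.
(* This is the passage to the limit in [t]: [phi t] can be made smaller than [e / c] for every
   [e > 0]. *)
have le_of_limit (a b c : R) : 0 < c ->
    (forall t, 0 <= t -> a <= b + c * phi t) -> a <= b.
  move=> c0 h; apply/ler_addgt0Pr => e e0.
  have [t t0 te] := phi_inf (e / c) (divr_gt0 e0 c0).
  rewrite (le_trans (h t t0))// lerD2l; move: te.
  by rewrite ltr_pdivlMr// mulrC => /ltW.
have C_le1 s : 0 <= s -> phi (q * s) * (p * phi s + q) <= phi s.
  move=> s0; rewrite -(ler_pM2r p0).
  rewrite [leRHS]mulrC; apply: (le_of_limit _ _ q) => // t t0.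
  have sq : 0 <= q * s by rewrite mulr_ge0// ltW.
  have tp : 0 <= p * t by rewrite mulr_ge0// ltW.
  have ps := phi_gt0 s s0; have pt := phi_gt0 t t0.
  (* Monotonicity gives [phi (q s + p t) <= phi (p t)], and the factor [phi (p t)] cancels from both
     sides. *)
  have : phi (q * s) * (p * phi s + q) * (p + q * phi t) <= p * phi s + q * phi t.
    have pp := phi_gt0 _ tp.
    rewrite -(ler_pM2l pp).
    apply: (@le_trans _ _ (phi (q * s + p * t) * (p * phi s + q * phi t))).
      by rewrite eq// le_eqVlt; apply/orP; left; apply/eqP; ring.
    rewrite ler_wpM2r//; first by nra.
    by rewrite phi_ni// lerDr.
  have := phi_gt0 _ sq; set c := phi (q * s); move=> c0.
  have : 0 <= c * (p * phi s + q) * (q * phi t) by rewrite !mulr_ge0//; nra.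
  lra.
have D_le1 t : 0 <= t -> phi (p * t) * (p + q * phi t) <= phi t.
  move=> t0; rewrite -(ler_pM2r q0).
  rewrite [leRHS]mulrC; apply: (le_of_limit _ _ p) => // s s0.
  have sq : 0 <= q * s by rewrite mulr_ge0// ltW.
  have tp : 0 <= p * t by rewrite mulr_ge0// ltW.
  have ps := phi_gt0 s s0; have pt := phi_gt0 t t0.
  have : phi (p * t) * (p + q * phi t) * (p * phi s + q) <= p * phi s + q * phi t.
    have pp := phi_gt0 _ sq.
    rewrite -(ler_pM2l pp).
    apply: (@le_trans _ _ (phi (q * s + p * t) * (p * phi s + q * phi t))).
      by rewrite eq// le_eqVlt; apply/orP; left; apply/eqP; ring.
    rewrite ler_wpM2r//; first by nra.
    by rewrite phi_ni// lerDl.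
  have := phi_gt0 _ tp; set c := phi (p * t); move=> c0.
  have : 0 <= c * (p + q * phi t) * (p * phi s) by rewrite !mulr_ge0//; nra.
  lra.
have CD1 s : 0 <= s -> phi (q * s) * (p * phi s + q) = phi s /\
                       phi (p * s) * (p + q * phi s) = phi s.
  move=> s0; have := eq s s s0 s0.
  have -> : q * s + p * s = s by rewrite pq; ring.
  have -> : p * phi s + q * phi s = phi s by rewrite pq; ring.
  have := C_le1 s s0; have := D_le1 s s0; have := phi_gt0 s s0.
  have : 0 < phi (q * s) * (p * phi s + q).
    apply: mulr_gt0; first by rewrite phi_gt0// mulr_ge0// ltW.
    by rewrite addr_gt0// mulr_gt0// phi_gt0.
  set x := _ * (_ + q); set y := _ * (_ + _ * _); set z := phi s.
  by move=> x0 z0 yz xz e; split; nra.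
(* The right side of the equation is now [phi s * phi t]; dividing by all three values of [phi]
   gives the identity. *)
have affine s t : 0 <= s -> 0 <= t ->
    (phi (q * s + p * t))^-1 = q * (phi s)^-1 + p * (phi t)^-1.
  move=> s0 t0; have := eq s t s0 t0; rewrite (CD1 s s0).1 (CD1 t t0).2.
  have st : 0 <= q * s + p * t by rewrite addr_ge0// mulr_ge0// ltW.
  have := phi_gt0 _ s0; have := phi_gt0 _ t0; have := phi_gt0 _ st.
  set a := phi s; set b := phi t; set c := phi (_ + _) => c0 b0 a0 e.
  apply: (mulfI (x := c * a * b)); first by rewrite !mulf_neq0 ?gt_eqF.
  by transitivity (a * b); [|rewrite -e]; field; rewrite ?gt_eqF.
(* Evaluating [affine] at [x / q] and [y / p], with [phi 0 = 1], shows this function to be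
   additive. *)
pose g s := (phi s)^-1 - 1.
have gD x y : 0 <= x -> 0 <= y -> g (x + y) = g x + g y.
  move=> x0 y0; have x'0 : 0 <= x / q by rewrite divr_ge0// ltW.
  have y'0 : 0 <= y / p by rewrite divr_ge0// ltW.
  have := affine _ _ x'0 y'0; have := affine _ _ x'0 (lexx 0).
  have := affine _ _ (lexx 0) y'0; rewrite phi0 !mulr0 addr0 add0r.
  have -> : q * (x / q) = x by rewrite mulrCA divff ?mulr1// gt_eqF.
  have -> : p * (y / p) = y by rewrite mulrCA divff ?mulr1// gt_eqF.
  by rewrite /g /q; lra.
have g0 x : 0 <= x -> 0 <= g x.
  move=> x0; rewrite /g subr_ge0 -invr1 lef_pV2 ?posrE ?phi_gt0//.
  by rewrite -phi0; exact: phi_ni.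
have gl := monotone_additive_linear gD g0.
exists (g 1) => [|s s0]; last by rewrite -gl// /g addrC subrK invrK.
(* A zero slope would make [phi] constantly 1 on the half-line, but [phi] takes values below 1. *)
rewrite lt_neqAle g0// andbT; apply/eqP => g10.
have [t t0 t1] := phi_inf 1 ltr01.
have := gl t t0; rewrite -g10 mul0r /g => /eqP; rewrite subr_eq0 => /eqP h.
by move: t1; rewrite -(invrK (phi t)) h invr1 ltxx.
Qed.

(** * Integration under almost-everywhere hypotheses *)

Section Rintegral_ae.
Context d (T : measurableType d) (R : realType) (mu : {measure set T -> \bar R}).
Implicit Types f g W : T -> R.

Lemma ae_le_integrable f W : measurable_fun setT f ->
  mu.-integrable setT (EFin \o W) -> {ae mu, forall x, `|f x| <= `|W x|} ->
  mu.-integrable setT (EFin \o f).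
Proof.
move=> mf /integrableP[mW Wfin] fW; apply/integrableP; split.
  exact/measurable_EFinP.
apply: le_lt_trans Wfin; apply: ae_ge0_le_integral => //.
- by apply: measurableT_comp => //; exact/measurable_EFinP.
- exact: measurableT_comp.
- by apply: filterS fW => x h _; rewrite /= lee_fin.
Qed.

Lemma ae_eq_Rintegral f g : measurable_fun setT f -> measurable_fun setT g ->
  {ae mu, forall x, f x = g x} -> \int[mu]_x f x = \int[mu]_x g x.
Proof.
move=> mf mg fg; congr fine; apply: ae_eq_integral => //.
- exact/measurable_EFinP.
- exact/measurable_EFinP.
- by apply: filterS fg => x + _ => ->.
Qed.

Lemma dominated_cvg_Rintegral (f_ : nat -> T -> R) f g :
  (forall n, measurable_fun setT (f_ n)) -> measurable_fun setT f ->
  {ae mu, forall x, f_ ^~ x @ \oo --> f x} ->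
  mu.-integrable setT (EFin \o g) ->
  {ae mu, forall x n, `|f_ n x| <= g x} ->
  (fun n => \int[mu]_x f_ n x) @ \oo --> \int[mu]_x f x.
Proof.
move=> mf_ mf f_f ig f_g.
have [intf _ cf] : [/\ mu.-integrable setT (EFin \o f),
   [sequence \int[mu]_x `|(f_ n x)%:E - (f x)%:E|]_n @ \oo --> 0 &
   [sequence \int[mu]_x (f_ n x)%:E]_n @ \oo --> \int[mu]_x (f x)%:E]%E.
  apply: (@dominated_convergence _ _ _ mu _ measurableT
    (fun n x => (f_ n x)%:E) (EFin \o f) (EFin \o g)) => //.
  - by move=> n; exact/measurable_EFinP.
  - exact/measurable_EFinP.
  - by apply: filterS f_f => x + _; exact: cvg_EFin (nearW _ _).
  - by apply: filterS f_g => x h n _; rewrite /= lee_fin.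
apply: fine_cvg; rewrite fineK//.
exact: integrable_fin_num.
Qed.

End Rintegral_ae.

(** * Inversion of Laplace transforms *)

Lemma measurable_laplace d (T : measurableType d) (R : realType) (X : T -> R) s :
  measurable_fun setT X -> measurable_fun setT (fun x => expR (- (s * X x))).
Proof.
move=> mX; apply: measurableT_comp => //; apply: measurableT_comp => //.
exact: measurable_funM.
Qed.

Section laplace_transform_tail.
Context d (T : measurableType d) (R : realType) (mu : {measure set T -> \bar R}).
(** The weight [W] lets one argument serve several purposes: it is the constant 1 for a single law,
    a density for Lebesgue measure, and a function of a second variable for a joint law. Positivity
    of [U] is asked only where [W] is nonzero, so that a density may vanish on the negative
    half-line. *)
Variables U W : T -> R.
Hypothesis mU : measurable_fun setT U.
Hypothesis iW : mu.-integrable setT (EFin \o W).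
Hypothesis U_gt0 : {ae mu, forall x, W x != 0 -> 0 < U x}.

Let mW : measurable_fun setT W.
Proof. by apply/measurable_EFinP; exact: measurable_int iW. Qed.

Let expR_itv s x : 0 <= s -> 0 < U x -> 0 <= expR (- (s * U x)) <= 1.
Proof.
by move=> s0 u0; rewrite expR_ge0 -expR0 ler_expR oppr_le0 mulr_ge0// ltW.
Qed.

Lemma integrable_laplace s : 0 <= s ->
  mu.-integrable setT (EFin \o (fun x => expR (- (s * U x)) * W x)).
Proof.
move=> s0; apply: ae_le_integrable iW _; first by apply: measurable_funM => //; exact: measurable_laplace.
apply: filterS U_gt0 => x; have [->|W0 /(_ isT) u0] := eqVneq (W x) 0.
  by rewrite mulr0.
have /andP[e0 e1] := expR_itv s0 u0.
by rewrite normrM ger0_norm// ler_piMl.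
Qed.

(** Powers of [exp (- s U)] are exponentials again, so these integrals are determined by the
    transform at the multiples of [s]. *)
Lemma Rintegral_horner_laplace (q : {poly R}) s : 0 <= s ->
  \int[mu]_x (q.[expR (- (s * U x))] * W x) =
  \sum_(i < size q) q`_i * \int[mu]_x (expR (- (i%:R * s * U x)) * W x).
Proof.
move=> s0.
have is0 (i : 'I_(size q)) : 0 <= i%:R * s by rewrite mulr_ge0.
transitivity (fine (\sum_(i < size q)
    \int[mu]_x (q`_i * (expR (- (i%:R * s * U x)) * W x))%:E)%E).
  congr fine; rewrite -integral_sum//; last first.
    move=> i; under eq_fun do rewrite EFinM.
    by apply: integrableZl => //; exact: integrable_laplace.
  apply: eq_integral => x _; rewrite horner_coef mulr_suml sumEFin.
  congr EFin; apply: eq_bigr => i _; rewrite -expRM_natl mulrN !mulrA//.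
rewrite -sum_fine; last first.
  move=> i _; apply: integrable_fin_num => //; under eq_fun do rewrite EFinM.
  by apply: integrableZl => //; exact: integrable_laplace.
by apply: eq_bigr => i _; rewrite -RintegralZl//; exact: integrable_laplace.
Qed.

(** The rate [s = ln 2 / c] moves the threshold [exp (- s x) = 1/2] to [x = c]. Dominated
    convergence applies with the bound [|W|]. *)
Lemma cvg_Rintegral_step_poly c : 0 < c ->
  (fun n => \int[mu]_x ((step_poly R n).[expR (- (ln 2 / c * U x))] * W x))
  @ \oo --> \int[mu]_x (\1_(`]c, +oo[%classic) (U x) * W x).
Proof.
move=> c0; have s0 : 0 < ln 2 / c by rewrite divr_gt0// ln_gt0// ltr1n.
apply: (@dominated_cvg_Rintegral _ _ _ _ _ _ (fun x => `|W x|)).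
- move=> n; apply: measurable_funM => //; under eq_fun do rewrite step_polyE.
  apply: measurable_funX; apply: measurable_funB => //; apply: measurable_funX.
  exact: measurable_laplace.
- apply: measurable_funM => //; apply: measurableT_comp => //.
- apply: filterS U_gt0 => x; have [->|W0 /(_ isT) u0] := eqVneq (W x) 0.
    by move=> _; rewrite mulr0; under eq_fun do rewrite mulr0; exact: cvg_cst.
  apply: cvgMl; rewrite indicE mem_setE in_itv/= andbT.
  have -> : (c < U x) = (expR (- (ln 2 / c * U x)) < 2^-1).
    rewrite -[X in _ < X^-1](@lnK _ 2) ?posrE// -expRN ltr_expR ltrN2.
    by rewrite mulrAC ltr_pdivlMr// ltr_pM2l// ln_gt0// ltr1n.
  by apply: cvg_step_poly; exact: expR_itv (ltW s0) u0.
- exact: integrable_norm.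
- apply: filterS U_gt0 => x; have [->|W0 /(_ isT) u0] := eqVneq (W x) 0.
    by move=> _ n; rewrite mulr0.
  move=> n; rewrite normrM ler_piMl// ger0_norm.
    by have /andP[] := step_poly_bound n (expR_itv (ltW s0) u0).
  by have /andP[] := step_poly_bound n (expR_itv (ltW s0) u0).
Qed.

Lemma Rintegral_ray_le0 c : c <= 0 ->
  \int[mu]_x (\1_(`]c, +oo[%classic) (U x) * W x) = \int[mu]_x W x.
Proof.
move=> c0; apply: ae_eq_Rintegral => //.
  by apply: measurable_funM => //; exact: measurableT_comp.
apply: filterS U_gt0 => x; have [->|W0 /(_ isT) u0] := eqVneq (W x) 0.
  by rewrite mulr0.
by rewrite indicE mem_setE in_itv/= andbT (le_lt_trans c0 u0) mul1r.
Qed.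

End laplace_transform_tail.

(* Polynomials in [expR (- s * U)] approximate the indicator of [c < U]. *)
Lemma laplace_transform_ray (R : realType) d1 d2 (T1 : measurableType d1)
    (T2 : measurableType d2) (mu1 : {measure set T1 -> \bar R})
    (mu2 : {measure set T2 -> \bar R}) (U1 W1 : T1 -> R) (U2 W2 : T2 -> R) :
  measurable_fun setT U1 -> measurable_fun setT U2 ->
  mu1.-integrable setT (EFin \o W1) -> mu2.-integrable setT (EFin \o W2) ->
  {ae mu1, forall x, W1 x != 0 -> 0 < U1 x} ->
  {ae mu2, forall x, W2 x != 0 -> 0 < U2 x} ->
  (forall s, 0 <= s -> \int[mu1]_x (expR (- (s * U1 x)) * W1 x) =
                       \int[mu2]_x (expR (- (s * U2 x)) * W2 x)) ->
  forall c, \int[mu1]_x (\1_(`]c, +oo[%classic) (U1 x) * W1 x) =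
            \int[mu2]_x (\1_(`]c, +oo[%classic) (U2 x) * W2 x).
Proof.
move=> mU1 mU2 iW1 iW2 U1_gt0 U2_gt0 lapE c; have [c0|c0] := leP c 0.
  (* No positive rate puts the threshold at [c <= 0]. There the indicator is 1 almost everywhere
     that the weight is nonzero, and the transforms at 0 give the total integrals. *)
  rewrite !Rintegral_ray_le0//.
  transitivity (\int[mu1]_x (expR (- (0 * U1 x)) * W1 x)); last rewrite lapE//;
    by apply: eq_Rintegral => x _; rewrite mul0r oppr0 expR0 mul1r.
have := cvg_Rintegral_step_poly mU1 iW1 U1_gt0 c0.
have := cvg_Rintegral_step_poly mU2 iW2 U2_gt0 c0.
have s0 : 0 <= ln 2 / c by rewrite divr_ge0 ?ln_ge0 ?ler1n// ltW.
have -> : (fun n => \int[mu1]_x ((step_poly R n).[expR (- (ln 2 / c * U1 x))] * W1 x))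
    = (fun n => \int[mu2]_x ((step_poly R n).[expR (- (ln 2 / c * U2 x))] * W2 x)).
  apply/funext => n; rewrite !Rintegral_horner_laplace//.
  by apply: eq_bigr => i _; rewrite lapE// mulr_ge0.
by move=> c2 c1; exact: cvg_unique c1 c2.
Qed.

(** The rays are closed under intersection and generate the Borel sets. The whole line is not a ray,
    whence the separate hypothesis on total masses. *)
Lemma measure_eq_rays (R : realType) (m1 m2 : {measure set R -> \bar R}) :
  (m1 setT < +oo)%E -> m1 setT = m2 setT ->
  (forall c, m1 `]c, +oo[%classic = m2 `]c, +oo[%classic) ->
  forall A, measurable A -> m1 A = m2 A.
Proof.
move=> fin1 m12 rays A mA.
pose G := [set A : set R | exists x, A = `]x, +oo[%classic].
have GT : [set X | G X /\ X `<=` setT] = G.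
  by apply/seteqP; split => [X []//|X GX]; split.
apply: (g_sigma_algebra_measure_unique_trace G setT) => //=; rewrite ?GT.
- by move=> _ [x ->]; exact: measurable_itv.
- move=> _ _ [x ->] [y ->]; exists (Num.max x y).
  by apply/seteqP; split => z /=; rewrite !in_itv/= !andbT gt_max => /andP.
- by move=> _ [[x ->] _].
- have <- : @measurable _ (measurableTypeR R) = <<s G >>.
    exact: RGenOInfty.measurableE.
  exact: mA.
Qed.

(** * Independence: integrals of products and reduction to rays *)

Lemma probability_integrable d (T : measurableType d) (R : realType)
    (P : probability T R) (f : T -> R) :
  measurable_fun setT f -> {ae P, forall x, `|f x| <= 1} ->
  P.-integrable setT (EFin \o f).
Proof.
move=> mf f1; apply: (@ae_le_integrable _ _ _ P _ (cst 1)) => //.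
- exact: finite_measure_integrable_cst.
- by apply: filterS f1 => x; rewrite normr1.
Qed.

Lemma Rintegral_indic_preimage d d' (T : measurableType d) (T' : measurableType d')
    (R : realType) (P : probability T R) (U : T -> T') (A : set T') :
  measurable_fun setT U -> measurable A ->
  (\int[P]_x (\1_A (U x)))%:E = P (U @^-1` A).
Proof.
move=> mU mA; have mUA : measurable (U @^-1` A) by rewrite -[_ @^-1` _]setTI; exact: mU.
rewrite /Rintegral (_ : (fun x => (\1_A (U x))%:E) = EFin \o \1_(U @^-1` A)).
  by rewrite integral_indic// setIT fineK// fin_num_measure.
by apply/funext => x /=; rewrite !indicE; congr (_%:R%:E); apply/idP/idP; rewrite !inE.
Qed.

(** Independence says that the joint law agrees on rectangles with the product of the marginals,
    hence everywhere by uniqueness of the product measure. Tonelli's theorem then separates the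
    variables. *)
Lemma independent_Rintegral d d1 d2 (T : measurableType d) (T1 : measurableType d1)
    (T2 : measurableType d2) (R : realType) (P : probability T R)
    (U : T -> T1) (V : T -> T2) (f : T1 -> R) (g : T2 -> R) :
  measurable_fun setT U -> measurable_fun setT V -> independent_RV P U V ->
  measurable_fun setT f -> measurable_fun setT g ->
  (forall x, 0 <= f x) -> (forall y, 0 <= g y) ->
  P.-integrable setT (EFin \o (f \o U)) -> P.-integrable setT (EFin \o (g \o V)) ->
  \int[P]_w (f (U w) * g (V w)) = \int[P]_w f (U w) * \int[P]_w g (V w).
Proof.
move=> mU mV ind mf mg f0 g0 ifU igV.
pose U' : {RV P >-> T1} := HB.pack U (isMeasurableFun.Build _ _ _ _ U mU).
pose V' : {RV P >-> T2} := HB.pack V (isMeasurableFun.Build _ _ _ _ V mV).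
pose UV w := (U w, V w).
have mUV : measurable_fun setT UV by exact: measurable_fun_pair.
pose UV' : {RV P >-> (T1 * T2)%type} :=
  HB.pack UV (isMeasurableFun.Build _ _ _ _ UV mUV).
have prodE X : measurable X ->
    (distribution P U' \x distribution P V')%E X = distribution P UV' X.
  apply: product_measure_unique => A B mA mB.
  by rewrite /distribution/= /pushforward/= -ind.
pose h (z : T1 * T2) := (f z.1 * g z.2)%:E.
have mh : measurable_fun setT h.
  by apply/measurable_EFinP; apply: measurable_funM; exact: measurableT_comp.
have h0 z : (0 <= h z)%E by rewrite lee_fin mulr_ge0.
rewrite /Rintegral -fineM; [|exact: integrable_fin_num|exact: integrable_fin_num].
congr fine; transitivity (\int[distribution P UV']_z h z)%E.
  by rewrite ge0_integral_distribution.
transitivity (\int[(distribution P U' \x distribution P V')]_z h z)%E.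
  by apply: eq_measure_integral => A mA _; exact/esym/prodE.
rewrite fubini_tonelli1//.
have <- : (\int[distribution P U']_x (f x)%:E = \int[P]_w (f (U w))%:E)%E.
  by rewrite ge0_integral_distribution//; exact/measurable_EFinP.
have <- : (\int[distribution P V']_x (g x)%:E = \int[P]_w (g (V w))%:E)%E.
  by rewrite ge0_integral_distribution//; exact/measurable_EFinP.
rewrite -ge0_integralZr//; last 3 first.
- exact/measurable_EFinP.
- by move=> x _; rewrite lee_fin.
- by apply: integral_ge0 => x _; rewrite lee_fin.
apply: eq_integral => x _; rewrite /fubini_F /h /=.
under eq_integral do rewrite EFinM.
rewrite ge0_integralZl//; first exact/measurable_EFinP.
- by move=> y _; rewrite lee_fin.
- by rewrite lee_fin.
Qed.

(** For fixed [E] both sides are finite measures in [A]: the restriction of [P] to [E] pushed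
    forward by [U], and the law of [U] scaled by [P E]. They agree on rays and have the same total
    mass. *)
Lemma event_independent_rays d (T : measurableType d) (R : realType)
    (P : probability T R) (U : T -> R) (E : set T) :
  measurable_fun setT U -> measurable E ->
  (forall c, P (U @^-1` `]c, +oo[ `&` E) = P (U @^-1` `]c, +oo[) * P E)%E ->
  forall A, measurable A -> P (U @^-1` A `&` E) = (P (U @^-1` A) * P E)%E.
Proof.
move=> mU mE rays.
pose U' : {RV P >-> R} := HB.pack U (isMeasurableFun.Build _ _ _ _ U mU).
pose k : {nonneg R} := NngNum (fine_ge0 (measure_ge0 P E)).
have kE : (k%:num)%:E = P E by rewrite /= fineK// fin_num_measure.
pose m1 := pushforward (mrestr P mE) U'.
pose m2 := mscale k (distribution P U').
have m2E A : m2 A = (P (U @^-1` A) * P E)%E by rewrite /m2 /mscale kE muleC.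
have m1E A : m1 A = P (U @^-1` A `&` E) by [].
move=> A mA; rewrite -m2E -m1E.
apply: measure_eq_rays => //.
- rewrite -[ltLHS]/(m1 setT) m1E preimage_setT setTI.
  by rewrite -ge0_fin_numE// fin_num_measure.
- by rewrite -[LHS]/(m1 setT) -[RHS]/(m2 setT) m2E m1E preimage_setT setTI probability_setT mul1e.
- by move=> c; rewrite -[LHS]/(m1 _) -[RHS]/(m2 _) m2E m1E rays.
Qed.

(** The sets are freed one at a time: first [A], with the event that [V] lies in [B] fixed, then
    [B], with the event [c < U] fixed. *)
Lemma independent_rays d (T : measurableType d) (R : realType)
    (P : probability T R) (U V : T -> R) :
  measurable_fun setT U -> measurable_fun setT V ->
  (forall c c', P (U @^-1` `]c, +oo[ `&` V @^-1` `]c', +oo[) =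
                P (U @^-1` `]c, +oo[) * P (V @^-1` `]c', +oo[))%E ->
  independent_RV P U V.
Proof.
move=> mU mV rays A B mA mB.
have mVB : measurable (V @^-1` B) by rewrite -[_ @^-1` _]setTI; exact: mV.
apply: event_independent_rays => // c.
have mUc : measurable (U @^-1` `]c, +oo[) by rewrite -[_ @^-1` _]setTI; exact: mU.
rewrite setIC muleC; apply: event_independent_rays => // c'.
by rewrite setIC muleC.
Qed.

(** * The Laplace transform of a positive random variable *)

Section laplace_transform_positive.
Context d (T : measurableType d) (R : realType) (P : probability T R) (X : T -> R).
Hypothesis mX : measurable_fun setT X.
Hypothesis X_gt0 : {ae P, forall w, 0 < X w}.

Lemma ae_laplace_itv s : 0 <= s ->
  {ae P, forall w, 0 <= expR (- (s * X w)) <= 1}.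
Proof.
move=> s0; apply: filterS X_gt0 => w X0.
by rewrite expR_ge0 -expR0 ler_expR oppr_le0 mulr_ge0// ltW.
Qed.

Lemma integrable_laplace_transform s : 0 <= s ->
  P.-integrable setT (EFin \o (fun w => expR (- (s * X w)))).
Proof.
move=> s0; apply: probability_integrable; first exact: measurable_laplace.
by apply: filterS (ae_laplace_itv s0) => w /andP[e0 e1]; rewrite ger0_norm.
Qed.

Lemma laplace_transform0 : \int[P]_w expR (- (0 * X w)) = 1.
Proof.
under eq_Rintegral do rewrite mul0r oppr0 expR0.
by rewrite Rintegral_cst// [X in fine X](@probability_setT _ _ _ P) mulr1.
Qed.

(** If the integral vanished, the nonnegative integrand would be zero almost everywhere; as it is
    zero nowhere, the whole space would be null. *)
Lemma laplace_transform_gt0 s : 0 <= s -> 0 < \int[P]_w expR (- (s * X w)).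
Proof.
move=> s0; rewrite lt_neqAle eq_sym Rintegral_ge0 ?andbT; last first.
  by move=> w _; rewrite expR_ge0.
apply/eqP => int0.
have : ae_eq P setT (EFin \o (fun w => expR (- (s * X w)))) (cst 0%E).
  apply/ae_eq_integral_abs => //.
    by apply/measurable_EFinP; exact: measurable_laplace.
  under eq_integral do rewrite /= ger0_norm ?expR_ge0//.
  rewrite -[LHS]fineK ?[fine _]int0//.
  exact: integrable_fin_num (integrable_laplace_transform s0).
move=> [N [mN N0 sN]]; have NT : N = setT.
  apply/seteqP; split => // w _; apply: sN => /= /(_ I) [].
  by apply/eqP; rewrite gt_eqF// expR_gt0.
by move: N0; rewrite NT [X in X = _](@probability_setT _ _ _ P) => /eqP; rewrite onee_eq0.
Qed.

Lemma laplace_transform_nonincreasing s t : 0 <= s -> s <= t ->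
  \int[P]_w expR (- (t * X w)) <= \int[P]_w expR (- (s * X w)).
Proof.
move=> s0 st; have t0 := le_trans s0 st.
rewrite /Rintegral fine_le//.
- exact: integrable_fin_num (integrable_laplace_transform t0).
- exact: integrable_fin_num (integrable_laplace_transform s0).
apply: ae_ge0_le_integral => //.
- by apply/measurable_EFinP; exact: measurable_laplace.
- by apply/measurable_EFinP; exact: measurable_laplace.
- apply: filterS X_gt0 => w X0 _.
  by rewrite lee_fin ler_expR lerN2 ler_pM2r.
Qed.

(** Dominated convergence along the integers: [exp (- n X) = exp (- X) ^ n] tends to 0 wherever
    [X > 0]. *)
Lemma laplace_transform_small e : 0 < e ->
  exists2 t, 0 <= t & \int[P]_w expR (- (t * X w)) < e.
Proof.
move=> e0.
have : (fun n => \int[P]_w expR (- (n%:R * X w))) @ \oo --> \int[P]_w (0 : R).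
  apply: (@dominated_cvg_Rintegral _ _ _ P _ _ (cst 1)) => //.
  - by move=> n; exact: measurable_laplace.
  - apply: filterS X_gt0 => w X0.
    under eq_fun do rewrite -mulrN expRM_natl.
    by apply: cvg_expr; rewrite ger0_norm ?expR_ge0// expR_lt1 oppr_lt0.
  - exact: finite_measure_integrable_cst.
  - apply: filterS X_gt0 => w X0 n; rewrite ger0_norm ?expR_ge0//=.
    by rewrite -expR0 ler_expR oppr_le0 mulr_ge0// ltW.
rewrite Rintegral_cst// mul0r => /cvgrPdist_lt/(_ e e0)[n _ /(_ n (leqnn n))] /=.
rewrite sub0r normrN => en; exists n%:R => //.
exact: le_lt_trans (ler_norm _) en.
Qed.

End laplace_transform_positive.

(** Inversion acts on one variable at a time: first on [U] with weight [exp (- t V)], then on [V]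
    with weight the indicator of [c < U]. Each time the weight is compared with its mean, so that
    equality of the ray integrals is a product rule. *)
Lemma independent_laplace d (T : measurableType d) (R : realType)
    (P : probability T R) (U V : T -> R) :
  measurable_fun setT U -> measurable_fun setT V ->
  {ae P, forall w, 0 < U w} -> {ae P, forall w, 0 < V w} ->
  (forall s t, 0 <= s -> 0 <= t ->
    \int[P]_w (expR (- (s * U w)) * expR (- (t * V w))) =
    \int[P]_w expR (- (s * U w)) * \int[P]_w expR (- (t * V w))) ->
  independent_RV P U V.
Proof.
move=> mU mV U0 V0 lapE.
have mind (X : T -> R) c : measurable_fun setT X ->
    measurable_fun setT (fun w => \1_(`]c, +oo[%classic) (X w) : R).
  by move=> mX; apply: measurableT_comp.
have iind (X : T -> R) c : measurable_fun setT X ->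
    P.-integrable setT (EFin \o (fun w => \1_(`]c, +oo[%classic) (X w))).
  move=> mX; apply: probability_integrable; first exact: mind.
  by apply: aeW => w; rewrite indicE; case: (_ \in _); rewrite ?normr1 ?normr0.
have icst (r : R) : P.-integrable setT (EFin \o (fun=> r)).
  exact: finite_measure_integrable_cst.
have step c t : 0 <= t ->
    \int[P]_w (expR (- (t * V w)) * \1_(`]c, +oo[%classic) (U w)) =
    \int[P]_w expR (- (t * V w)) * \int[P]_w \1_(`]c, +oo[%classic) (U w).
  move=> t0; under eq_Rintegral do rewrite mulrC.
  rewrite [RHS]mulrC -RintegralZr//; last exact: iind.
  apply: laplace_transform_ray => //.
  - exact: integrable_laplace_transform.
  - by apply: filterS U0.
  - by apply: filterS U0.
  - by move=> s s0; rewrite lapE// RintegralZr//; exact: integrable_laplace_transform.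
apply: independent_rays => // c c'.
have mUc : measurable (U @^-1` `]c, +oo[) by rewrite -[_ @^-1` _]setTI; exact: mU.
have mVc : measurable (V @^-1` `]c', +oo[) by rewrite -[_ @^-1` _]setTI; exact: mV.
rewrite -!Rintegral_indic_preimage// -EFinM.
have UVE : (U @^-1` `]c, +oo[ `&` V @^-1` `]c', +oo[) =
    (fun w => (U w, V w)) @^-1` (`]c, +oo[ `*` `]c', +oo[) by [].
rewrite UVE -Rintegral_indic_preimage//; last 2 first.
- exact: measurable_fun_pair.
- exact: measurableX.
congr EFin; rewrite [RHS]mulrC -RintegralZr//; last exact: iind.
rewrite -(@laplace_transform_ray _ _ _ _ _ P P V
  (fun w => \1_(`]c, +oo[%classic) (U w)))//.
- by apply: eq_Rintegral => w _; rewrite mulrC !indicE in_setX -mulnb natrM.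
- exact: iind.
- by apply: filterS V0.
- by apply: filterS V0.
- by move=> t t0; rewrite step// RintegralZr//; exact: integrable_laplace_transform.
Qed.

(** * The exponential law and its Laplace transform *)

(** Over every measurable set [h] has the same integral as the Radon-Nikodym derivative, so the two
    agree almost everywhere and the change of variables for the derivative carries over to [h]. *)
Lemma integral_density d (T : measurableType d) (R : realType)
    (nu : {finite_measure set T -> \bar R})
    (mu : {sigma_finite_measure set T -> \bar R}) (h f : T -> \bar R) :
  mu.-integrable setT h ->
  (forall A, measurable A -> nu A = \int[mu]_(x in A) h x)%E ->
  nu.-integrable setT f ->
  (\int[nu]_x f x = \int[mu]_x (f x * h x))%E.
Proof.
move=> ih nuE intf.
have numu : charge_of_finite_measure nu `<< mu.
  apply/null_content_dominatesP => A mA muA0.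
  rewrite -[LHS]/(nu A) nuE// null_set_integral//.
  by apply: measurable_funTS; exact: measurable_int ih.
rewrite -(Radon_Nikodym_change_of_variables numu)//.
have mf : measurable_fun setT f by exact: measurable_int intf.
apply: ae_eq_integral => //.
- by apply: emeasurable_funM => //; apply: (measurable_int mu); exact: Radon_Nikodym_integrable.
- by apply: emeasurable_funM => //; exact: measurable_int ih.
- apply: ae_eqe_mul2l => /=; apply: integral_ae_eq => //.
  + exact: Radon_Nikodym_integrable.
  + exact: measurable_int ih.
  + by move=> A _ mA; rewrite -Radon_Nikodym_integral// -[LHS]/(nu A) nuE.
Qed.

(** Multiplying the density of rate [r] by [exp (- s x)] gives [r / (r + s)] times the density of
    rate [r + s], whose total mass is 1. *)
Lemma laplace_exponential_pdf (R : realType) (r s : R) : 0 < r -> 0 <= s ->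
  \int[lebesgue_measure]_x (expR (- (s * x)) * exponential_pdf r x) = r / (r + s).
Proof.
move=> r0 s0; have rs0 : 0 < r + s by rewrite ltr_wpDr.
transitivity (\int[lebesgue_measure]_x (r / (r + s) * exponential_pdf (r + s) x)).
  apply: eq_Rintegral => x _; have [x0|x0] := leP 0 x.
    rewrite !exponential_pdfE// mulrCA -expRD mulrA divfK ?gt_eqF//.
    by congr (_ * expR _); ring.
  by rewrite !lt0_exponential_pdf// !mulr0.
rewrite RintegralZl//; last exact: integrable_exponential_pdf.
by rewrite /Rintegral integral_exponential_pdf// mulr1.
Qed.

(** The density takes the value [r] at 0, so this point is discarded as a null set. *)
Lemma exponential_pdf_support (R : realType) (r : R) :
  {ae lebesgue_measure, forall x, exponential_pdf r x != 0 -> 0 < x}.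
Proof.
exists [set 0]; split => //; first exact: lebesgue_measure_set1.
move=> x /= /not_implyP[pdf0 /negP]; rewrite -leNgt le_eqVlt => /predU1P[//|x0].
by rewrite lt0_exponential_pdf ?eqxx in pdf0.
Qed.

Lemma laplace_exponentially_distributed d (T : measurableType d) (R : realType)
    (P : probability T R) (X : {RV P >-> R}) (lambda s : R) :
  0 < lambda -> 0 <= s ->
  {ae P, forall w, 0 < X w} ->
  (forall A, measurable A -> distribution P X A = exponential_prob lambda^-1 A) ->
  \int[P]_w expR (- (s * X w)) = (1 + lambda * s)^-1.
Proof.
move=> l0 s0 X0 XE; have r0 : 0 < lambda^-1 by rewrite invr_gt0.
have mX : measurable_fun [set: T] (X : T -> measurableTypeR R).
  exact: (measurable_funPT X).
(* The variable is repackaged with the codomain on which Lebesgue measure and the exponential law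
   live. *)
pose X' : {RV P >-> measurableTypeR R} :=
  HB.pack (X : T -> measurableTypeR R) (isMeasurableFun.Build _ _ _ _ _ mX).
have mexp : measurable_fun [set: measurableTypeR R] (fun x : R => expR (- (s * x))).
  exact: measurable_laplace.
transitivity (lambda^-1 / (lambda^-1 + s)); last first.
  have ls0 : 0 <= lambda * s by rewrite mulr_ge0// ltW.
  by field; rewrite !gt_eqF//; lra.
rewrite -laplace_exponential_pdf// /Rintegral; congr fine.
rewrite -(@ge0_integral_distribution _ _ _ _ _ P X' (fun x => (expR (- (s * x)))%:E))//; last exact/measurable_EFinP.
under [RHS]eq_integral do rewrite EFinM.
apply: (@integral_density _ _ _ _ lebesgue_measure (fun x => (exponential_pdf lambda^-1 x)%:E)) => //.
  exact: integrable_exponential_pdf.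
apply/integrableP; split; first exact/measurable_EFinP.
under eq_integral do rewrite /= ger0_norm ?expR_ge0//.
rewrite ge0_integral_distribution//; last exact/measurable_EFinP.
have /integrableP[_] := integrable_laplace_transform (measurable_funPT X) X0 s0.
by under eq_integral do rewrite /= ger0_norm ?expR_ge0//.
Qed.

(** Inversion compares [X] under [P] with weight 1 to the identity under Lebesgue measure weighted
    by the density. *)
Lemma exponentially_distributed_laplace d (T : measurableType d) (R : realType)
    (P : probability T R) (X : {RV P >-> R}) (lambda : R) :
  0 < lambda -> {ae P, forall w, 0 < X w} ->
  (forall s, 0 <= s -> \int[P]_w expR (- (s * X w)) = (1 + lambda * s)^-1) ->
  exponentially_distributed X.
Proof.
move=> l0 X0 XE; have r0 : 0 < lambda^-1 by rewrite invr_gt0.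
exists lambda => //.
have ipdf := integrable_exponential_pdf r0.
have mid : measurable_fun [set: measurableTypeR R] (id : measurableTypeR R -> R).
  by move=> _ A mA; rewrite setTI.
(* Pushing forward by the identity transports the exponential law to [R], where the law of [X]
   lives. *)
pose I : {mfun measurableTypeR R >-> R} :=
  HB.pack (id : measurableTypeR R -> R) (isMeasurableFun.Build _ _ _ _ _ mid).
move=> A mA; rewrite -[RHS]/(pushforward (exponential_prob lambda^-1) I A).
apply: measure_eq_rays => //.
- by rewrite -[ltLHS]/(P (X @^-1` setT)) preimage_setT probability_setT ltry.
- rewrite -[LHS]/(P (X @^-1` setT)) preimage_setT probability_setT.
  by rewrite -[RHS]/(exponential_prob _ setT) /exponential_prob integral_exponential_pdf.
move=> c.
rewrite -[LHS]/(P (X @^-1` `]c, +oo[)) -Rintegral_indic_preimage//.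
rewrite -[RHS]/(exponential_prob lambda^-1 `]c, +oo[%classic).
rewrite /exponential_prob -[RHS]fineK; last first.
  by apply: integrable_fin_num => //; exact: integrableS ipdf.
congr EFin; rewrite -[RHS]/(\int[lebesgue_measure]_(x in `]c, +oo[) _).
rewrite [RHS]Rintegral_mkcond.
transitivity (\int[P]_w (\1_(`]c, +oo[%classic) (X w) * cst 1 w)).
  by apply: eq_Rintegral => w _; exact/esym/mulr1.
rewrite (@laplace_transform_ray _ _ _ _ _ P lebesgue_measure X (cst 1) id
  (exponential_pdf lambda^-1))//.
- apply: eq_Rintegral => x _; rewrite patchE indicE /=.
  by case: (_ \in _); rewrite ?mul1r ?mul0r.
- exact: finite_measure_integrable_cst.
- by apply: filterS X0.
- exact: exponential_pdf_support.
- move=> s s0; rewrite laplace_exponential_pdf//.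
  under eq_Rintegral do rewrite /= mulr1.
  have ls0 : 0 <= lambda * s by rewrite mulr_ge0// ltW.
  by rewrite XE//; field; rewrite !gt_eqF//; lra.
Qed.

Lemma identically_distributed_laplace d (T : measurableType d) (R : realType)
    (P : probability T R) (X Y : {RV P >-> R}) s :
  identically_distributed X Y ->
  \int[P]_w expR (- (s * Y w)) = \int[P]_w expR (- (s * X w)).
Proof.
move=> idXY; have mexp : measurable_fun [set: R] (fun x : R => (expR (- (s * x)))%:E).
  by apply/measurable_EFinP; exact: measurable_laplace.
rewrite /Rintegral; congr fine.
rewrite -(ge0_integral_distribution Y mexp); last by move=> x; rewrite lee_fin expR_ge0.
rewrite -(ge0_integral_distribution X mexp); last by move=> x; rewrite lee_fin expR_ge0.
by apply: eq_measure_integral => A mA _; exact/esym/idXY.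
Qed.

(** * The joint transform of the two linear forms *)

Section linear_forms.
Context (R : realType) (d : measure_display) (T : measurableType d)
  (P : probability T R) (p : R) (eps X Y : {RV P >-> R}).
Hypothesis eps1 : P (eps @^-1` [set 1]) = p%:E.
Hypothesis eps0 : P (eps @^-1` [set 0]) = (1 - p)%:E.
Hypothesis indXY : independent_RV P X Y.
Hypothesis X_gt0 : {ae P, forall w, 0 < X w}.
Hypothesis Y_gt0 : {ae P, forall w, 0 < Y w}.
Hypothesis ind_eps : independent_RV P eps (fun w => (X w, Y w)).

Let mX : measurable_fun setT X. Proof. exact: measurable_funPT. Qed.
Let mY : measurable_fun setT Y. Proof. exact: measurable_funPT. Qed.
Let meps : measurable_fun setT eps. Proof. exact: measurable_funPT. Qed.

(** The two disjoint events have masses adding up to [p + (1 - p) = 1], so their complement is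
    null. *)
Lemma bernoulli_ae : {ae P, forall w, eps w = 1 \/ eps w = 0}.
Proof.
have m1 : measurable (eps @^-1` [set 1]) by exact: measurable_funPTI.
have m0 : measurable (eps @^-1` [set 0]) by exact: measurable_funPTI.
have PP : (P (eps @^-1` [set 1%R]) + P (eps @^-1` [set 0%R]) = 1)%E.
  by rewrite eps1 eps0 -EFinD addrC subrK.
exists (~` (eps @^-1` [set 1] `|` eps @^-1` [set 0])); split.
- by apply: measurableC; exact: measurableU.
- rewrite probability_setC; last exact: measurableU.
  rewrite measureU//; first by rewrite [X in (_ - X)%E]PP subee.
  by apply/seteqP; split => // w [/= -> /eqP]; rewrite oner_eq0.
- by move=> w /= h.
Qed.

(** This is the contribution of the event [eps = e]. Independence enters twice: it separates [eps]
    from the pair, then [X] from [Y]. *)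
Lemma Rintegral_bernoulli_laplace (e u v : R) : 0 <= u -> 0 <= v ->
  P.-integrable setT
    (EFin \o (fun w => \1_[set e] (eps w) * (expR (- (u * X w)) * expR (- (v * Y w))))) /\
  \int[P]_w (\1_[set e] (eps w) * (expR (- (u * X w)) * expR (- (v * Y w)))) =
  fine (P (eps @^-1` [set e])) *
    (\int[P]_w expR (- (u * X w)) * \int[P]_w expR (- (v * Y w))).
Proof.
move=> u0 v0.
have mu := measurable_laplace u mX; have mv := measurable_laplace v mY.
have m1 : measurable_fun setT (fun w => \1_[set e] (eps w) : R).
  by apply: measurableT_comp => //; exact: measurable_indic.
have XY1 : {ae P, forall w, 0 <= expR (- (u * X w)) * expR (- (v * Y w)) <= 1}.
  apply: filterS2 (ae_laplace_itv X_gt0 u0) (ae_laplace_itv Y_gt0 v0) => w.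
  by move=> /andP[? ?] /andP[? ?]; rewrite mulr_ge0//= mulr_ile1.
split.
  apply: probability_integrable.
    by apply: measurable_funM => //; exact: measurable_funM.
  apply: filterS XY1 => w /andP[h0 h1]; rewrite normrM [X in _ * X]ger0_norm//.
  by rewrite mulr_ile1// indicE; case: (_ \in _); rewrite ?normr1 ?normr0.
rewrite (@independent_Rintegral _ _ _ _ _ _ _ P eps (fun w => (X w, Y w))
  \1_[set e] (fun z => expR (- (u * z.1)) * expR (- (v * z.2))))//; last 4 first.
- exact: measurable_fun_pair.
- apply: measurable_funM; first exact: measurable_laplace.
  exact: measurable_laplace.
- apply: probability_integrable => //.
  by apply: aeW => w /=; rewrite indicE; case: (_ \in _); rewrite ?normr1 ?normr0.
- apply: probability_integrable; first exact: measurable_funM.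
  by apply: filterS XY1 => w /andP[h0 h1]; rewrite ger0_norm.
rewrite -Rintegral_indic_preimage//; congr (_ * _).
rewrite (@independent_Rintegral _ _ _ _ _ _ _ P X Y
  (fun x => expR (- (u * x))) (fun y => expR (- (v * y))))//.
- exact: measurable_laplace.
- exact: measurable_laplace.
- exact: integrable_laplace_transform.
- exact: integrable_laplace_transform.
Qed.

(** The exponent is [- (u X + a s Y)] on [eps = 1] and [- (u X + b t Y)] on [eps = 0], with the same
    [u = (1 - p) a s + p b t]; the two events have weights [p] and [1 - p]. *)
Lemma joint_laplace_transform (a b s t : R) : 0 < p -> p < 1 ->
  0 < a -> 0 < b -> 0 <= s -> 0 <= t ->
  \int[P]_w (expR (- (s * ((1 - p) * a * X w + eps w * a * Y w))) *
             expR (- (t * (p * b * X w + (1 - eps w) * b * Y w)))) =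
  \int[P]_w expR (- (((1 - p) * (a * s) + p * (b * t)) * X w)) *
  (p * \int[P]_w expR (- (a * s * Y w)) +
   (1 - p) * \int[P]_w expR (- (b * t * Y w))).
Proof.
move=> p0 p1 a0 b0 s0 t0.
have as0 : 0 <= a * s by rewrite mulr_ge0// ltW.
have bt0 : 0 <= b * t by rewrite mulr_ge0// ltW.
have u0 : 0 <= (1 - p) * (a * s) + p * (b * t).
  by rewrite addr_ge0// mulr_ge0// ?subr_ge0 ltW.
set u := _ + _ in u0 *.
have [i1 E1] := Rintegral_bernoulli_laplace 1 u0 as0.
have [i0 E0] := Rintegral_bernoulli_laplace 0 u0 bt0.
rewrite eps1 /= in E1; rewrite eps0 /= in E0.
transitivity (\int[P]_w
  (\1_[set 1] (eps w) * (expR (- (u * X w)) * expR (- (a * s * Y w))) +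
   \1_[set 0] (eps w) * (expR (- (u * X w)) * expR (- (b * t * Y w))))).
  apply: ae_eq_Rintegral.
  - apply: measurable_funM; apply: measurable_laplace; apply: measurable_funD;
      do ?[apply: measurable_funM => //]; exact: measurable_funB.
  - by apply: measurable_funD; apply/measurable_EFinP;
      [exact: measurable_int i1|exact: measurable_int i0].
  - apply: filterS bernoulli_ae => w.
    rewrite !indicE !in_set1 -!expRD => -[] ->.
      rewrite eqxx oner_eq0 [X in _ = X + _]mul1r [X in _ = _ + X]mul0r [RHS]addr0.
      by rewrite /u; congr expR; ring.
    rewrite eqxx eq_sym oner_eq0 [X in _ = X + _]mul0r [X in _ = _ + X]mul1r.
    by rewrite [RHS]add0r /u; congr expR; ring.
rewrite RintegralD// E1 E0; ring.
Qed.

End linear_forms.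

(** * Independence of the forms and exponentiality *)

Theorem theorem2p1 (R : realType) (d : measure_display) (T : measurableType d)
    (P : probability T R) (p : R) (eps X Y : {RV P >-> R}) (a b : R)
    (p_gt0 : 0 < p) (p_lt1 : p < 1)
    (eps1 : P (eps @^-1` [set 1]) = p%:E)
    (eps0 : P (eps @^-1` [set 0]) = (1 - p)%:E)
    (indXY : independent_RV P X Y)
    (idXY : identically_distributed X Y)
    (X_gt0 : {ae P, forall w, 0 < X w})
    (Y_gt0 : {ae P, forall w, 0 < Y w})
    (ind_eps : independent_RV P eps (fun w => (X w, Y w)))
    (a_gt0 : 0 < a) (b_gt0 : 0 < b) :
  independent_RV P
    (fun w => (1 - p) * a * X w + eps w * a * Y w)
    (fun w => p * b * X w + (1 - eps w) * b * Y w)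
  <-> exponentially_distributed X /\ exponentially_distributed Y.
Proof.
set L1 := fun w => _; set L2 := fun w => _.
have mX : measurable_fun setT X by exact: measurable_funPT.
have mY : measurable_fun setT Y by exact: measurable_funPT.
have meps : measurable_fun setT eps by exact: measurable_funPT.
have mL1 : measurable_fun setT L1.
  by apply: measurable_funD; do ?[apply: measurable_funM => //].
have mL2 : measurable_fun setT L2.
  by apply: measurable_funD; do ?[apply: measurable_funM => //]; exact: measurable_funB.
have q_gt0 : 0 < 1 - p by rewrite subr_gt0.
have L1_gt0 : {ae P, forall w, 0 < L1 w}.
  apply: filterS3 (bernoulli_ae eps1 eps0) X_gt0 Y_gt0 => w e X0 Y0.
  rewrite ltr_pwDl ?mulr_gt0//.
  by case: e => ->; rewrite ?mul0r// mul1r mulr_ge0// ltW.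
have L2_gt0 : {ae P, forall w, 0 < L2 w}.
  apply: filterS3 (bernoulli_ae eps1 eps0) X_gt0 Y_gt0 => w e X0 Y0.
  rewrite ltr_pwDl ?mulr_gt0//.
  by case: e => ->; rewrite ?subrr ?mul0r// subr0 mul1r mulr_ge0// ltW.
pose phi s := \int[P]_w expR (- (s * X w)).
have phiY s : \int[P]_w expR (- (s * Y w)) = phi s.
  exact: identically_distributed_laplace.
have phi0 : phi 0 = 1 := laplace_transform0 P X.
have joint s t : 0 <= s -> 0 <= t ->
    \int[P]_w (expR (- (s * L1 w)) * expR (- (t * L2 w))) =
    phi ((1 - p) * (a * s) + p * (b * t)) *
    (p * phi (a * s) + (1 - p) * phi (b * t)).
  move=> s0 t0.
  etransitivity.
    exact: (joint_laplace_transform eps1 eps0 indXY X_gt0 Y_gt0 ind_eps).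
  by congr (_ * (p * _ + (1 - p) * _)); exact: phiY.
(* Each marginal transform is the joint transform with the other argument set to 0, where [phi] is
   1. *)
have lapL1 s : 0 <= s -> \int[P]_w expR (- (s * L1 w)) =
    phi ((1 - p) * (a * s)) * (p * phi (a * s) + (1 - p)).
  move=> s0; have := joint s 0 s0 (lexx 0).
  rewrite !mulr0 addr0 phi0 mulr1 => <-.
  by apply: eq_Rintegral => w _; rewrite mul0r oppr0 expR0 mulr1.
have lapL2 t : 0 <= t -> \int[P]_w expR (- (t * L2 w)) =
    phi (p * (b * t)) * (p + (1 - p) * phi (b * t)).
  move=> t0; have := joint 0 t (lexx 0) t0.
  rewrite !mulr0 add0r phi0 mulr1 => <-.
  by apply: eq_Rintegral => w _; rewrite mul0r oppr0 expR0 mul1r.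
split=> [indL|[[lambda lambda_gt0 XE] _]].
  have [||||||lambda lambda_gt0 phiE] :=
    @linear_forms_functional_equation R p phi.
  - by rewrite p_gt0.
  - by move=> s; exact: laplace_transform_gt0.
  - by move=> s t; exact: laplace_transform_nonincreasing.
  - exact: phi0.
  - by move=> e; exact: laplace_transform_small.
  - move=> s t s0 t0.
    (* Evaluating at [s / a] and [t / b] removes the scale constants and leaves the functional
       equation in [s] and [t]. *)
    have sa : 0 <= s / a by rewrite divr_ge0// ltW.
    have tb : 0 <= t / b by rewrite divr_ge0// ltW.
    have aK : a * (s / a) = s by rewrite mulrCA divff ?gt_eqF// mulr1.
    have bK : b * (t / b) = t by rewrite mulrCA divff ?gt_eqF// mulr1.
    have := joint _ _ sa tb; have := lapL1 _ sa; have := lapL2 _ tb.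
    rewrite aK bK => <- <- <-.
    apply: (@independent_Rintegral _ _ _ _ _ _ _ P L1 L2
      (fun x => expR (- (s / a * x))) (fun y => expR (- (t / b * y)))) => //.
    + exact: measurable_laplace.
    + exact: measurable_laplace.
    + exact: integrable_laplace_transform.
    + exact: integrable_laplace_transform.
  split; first exact: (exponentially_distributed_laplace lambda_gt0 X_gt0 phiE).
  apply: (exponentially_distributed_laplace lambda_gt0 Y_gt0) => s s0.
  exact: etrans (phiY s) (phiE s s0).
have phiE s : 0 <= s -> phi s = (1 + lambda * s)^-1.
  by move=> s0; exact: laplace_exponentially_distributed.
apply: independent_laplace => // s t s0 t0.
have as0 : 0 <= a * s by rewrite mulr_ge0// ltW.
have bt0 : 0 <= b * t by rewrite mulr_ge0// ltW.
have qas0 : 0 <= (1 - p) * (a * s) by rewrite mulr_ge0// ltW.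
have pbt0 : 0 <= p * (b * t) by rewrite mulr_ge0// ltW.
(* For [phi z = 1 / (1 + lambda z)] the joint transform collapses to [phi (a s) * phi (b t)], and
   the two marginal transforms to [phi (a s)] and [phi (b t)]. *)
rewrite joint// lapL1// lapL2// !phiE ?addr_ge0//.
have den z : 0 <= z -> 1 + lambda * z != 0.
  by move=> z0; rewrite gt_eqF// ltr_pwDl// mulr_ge0// ltW.
have := den _ as0; have := den _ bt0; have := den _ qas0; have := den _ pbt0.
have := den _ (addr_ge0 qas0 pbt0).
move=> h1 h2 h3 h4 h5; by field; rewrite h1 h2 h3 h4 h5.
Qed.
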